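(* Let $(\mathfrak J,\circ,\alpha,\beta)$ be a BiHom-pre-Jordan superalgebra. Then the bilinear map $\ast:\mathfrak J\times\mathfrak J\to\mathfrak J$ defined by $$x\ast y=x\circ y+(-1)^{|x||y|}\alpha^{-1}\beta(y)\circ\alpha\beta^{-1}(x),\qquad x,y\in\mathcal H(\mathfrak J),$$ makes $(\mathfrak J,\ast,\alpha,\beta)$ a BiHom-Jordan superalgebra.
   Context: Vector spaces are over an algebraically closed field $\mathbb K$ of characteristic $0$. For a $\mathbb Z_2$-graded vector space $W$, $\mathcal H(W)$ denotes the set of homogeneous elements and $|x|$ the parity of $x$; even (bi)linear maps preserve the $\mathbb Z_2$-degree. A BiHom-Jordan superalgebra is a quadruple $(\mathfrak J,\cdot,\alpha,\beta)$ with $\mathfrak J$ a $\mathbb Z_2$-graded vector space, $\cdot$ an even bilinear product and $\alpha,\beta:\mathfrak J\to\mathfrak J$ two even commuting linear maps such that for all $x,y,z,t\in\mathcal H(\mathfrak J)$: $\beta(x)\cdot\alpha(y)=(-1)^{|x||y|}\beta(y)\cdot\alpha(x)$, and $$\circlearrowleft_{x,y,t}(-1)^{|t|(|x|+|z|)}ass_{\alpha,\beta}\big(\beta^2(x)\cdot\alpha\beta(y),\alpha^2\beta(z),\alpha^3(t)\big)=0,$$ with cyclic sum over $(x,y,t)$ and $ass_{\alpha,\beta}(a,b,c)=(a\cdot b)\cdot\beta(c)-\alpha(a)\cdot(b\cdot c)$. A BiHom-pre-Jordan superalgebra is a quadruple $(\mathfrak J,\circ,\alpha,\beta)$ with $\mathfrak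 J$ a $\mathbb Z_2$-graded vector space, $\circ$ an even bilinear product and $\alpha,\beta:\mathfrak J\to\mathfrak J$ two even commuting bijective linear maps such that, with $x\ast y=x\circ y+(-1)^{|x||y|}\alpha^{-1}\beta(y)\circ\alpha\beta^{-1}(x)$, for all $x,y,z,t\in\mathcal H(\mathfrak J)$ (with $\sum_{x,y,z}$ the cyclic sum over $(x,y,z)$): (P1) $\alpha(x\circ y)=\alpha(x)\circ\alpha(y)$ and $\beta(x\circ y)=\beta(x)\circ\beta(y)$; (P2) $\sum_{x,y,z}(-1)^{|x||z|}\big(\alpha\beta^2(x)\ast\alpha^2\beta(y)\big)\circ(\alpha^2\beta(z)\circ\alpha^3(t))=(-1)^{|x||z|}\big((\beta^2(x)\ast\alpha\beta(y))\ast\alpha^2\beta(z)\big)\circ\alpha^3\beta(t)+(-1)^{|z|(|x|+|y|)}\alpha^2\beta^2(x)\circ\big(\alpha^2\beta(z)\circ(\alpha^2(y)\circ\alpha^3\beta^{-1}(t))\big)+(-1)^{|x||y|}\alpha^2\beta^2(y)\circ\big(\alpha^2\beta(z)\circ(\alpha^2(x)\circ\alpha^3\beta^{-1}(t))\big)$; (P3) $\sum_{x,y,z}(-1)^{|x||z|}\alpha^2\beta^2(x)\circ\big((\alpha\beta(y)\ast\alpha^2(z))\circ\alpha^3(t)\big)=\sum_{x,y,z}(-1)^{|x||z|}\big(\alpha\beta^2(x)\ast\alpha^2\beta(y)\big)\circ(\alpha^2\beta(z)\circ\alpha^3(t))$. *)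

(* Defs.v *)
From HB Require Import structures.
From mathcomp Require Import all_boot all_algebra.

Set Implicit Arguments.
Unset Strict Implicit.
Unset Printing Implicit Defensive.

Import GRing.Theory.
Local Open Scope ring_scope.

(* Parities live in bool, with addition (+) and with the coercion to nat in  *)
(* exponents of -1.                                                          *)
Record superspace (K : fieldType) := Superspace {
  carrier :> lmodType K;
  homog : bool -> {pred carrier};
  homog_closed : forall i, submod_closed (homog i);
  homog_split : forall x, exists x0 x1,
    [/\ x0 \in homog false, x1 \in homog true & x = x0 + x1];
  homog_disjoint : forall x,
    x \in homog false -> x \in homog true -> x = 0
}.

Arguments homog {K} s _.

Section HomogeneousComponents.

Variables (K : fieldType) (J : superspace K).

Lemma homog_lin (i : bool) (a : K) (x y : J) :
  x \in homog J i -> y \in homog J i -> a *: x + y \in homog J i.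
Proof. by case: (homog_closed J i) => _; apply. Qed.

Lemma homog0 (i : bool) : (0 : J) \in homog J i.
Proof. by case: (homog_closed J i). Qed.

Definition splits (x : J) (p : J * J) :=
  [&& p.1 \in homog J false, p.2 \in homog J true & x == p.1 + p.2].

Lemma splits_ex (x : J) : exists p, splits x p.
Proof.
have [x0 [x1 [h0 h1 ->]]] := homog_split x.
by exists (x0, x1); rewrite /splits /= h0 h1 eqxx.
Qed.

Definition hpart (i : bool) (x : J) : J :=
  if i then (xchoose (splits_ex x)).2 else (xchoose (splits_ex x)).1.

Lemma hpart_homog i x : hpart i x \in homog J i.
Proof.
by have /and3P[h0 h1 _] := xchooseP (splits_ex x); rewrite /hpart; case: i.
Qed.

Lemma hpart_sum x : x = hpart false x + hpart true x.
Proof. by have /and3P[_ _ /eqP] := xchooseP (splits_ex x). Qed.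

Lemma splits_uniq (x y z u : J) :
  x \in homog J false -> y \in homog J true ->
  z \in homog J false -> u \in homog J true ->
  x + y = z + u -> x = z /\ y = u.
Proof.
move=> hx hy hz hu e.
have e' : x - z = u - y.
  by apply/eqP; rewrite subr_eq addrAC eq_sym subr_eq addrC e addrC.
have hxz : x - z \in homog J false.
  by rewrite addrC -scaleN1r; apply: homog_lin.
have huy : u - y \in homog J true.
  by rewrite addrC -scaleN1r; apply: homog_lin.
have xz0 : x - z = 0 by apply: homog_disjoint => //; rewrite e'.
split; first by apply/eqP; rewrite -subr_eq0 xz0.
by apply/esym/eqP; rewrite -subr_eq0 -e' xz0.
Qed.

Lemma hpart_eq x x0 x1 :
  x0 \in homog J false -> x1 \in homog J true -> x = x0 + x1 ->
  hpart false x = x0 /\ hpart true x = x1.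
Proof.
by move=> h0 h1 e; apply: splits_uniq; rewrite ?hpart_homog // -hpart_sum.
Qed.

Lemma hpart_id i j x :
  x \in homog J i -> hpart j x = if j == i then x else 0.
Proof.
case: i => hx.
  have [] := hpart_eq (homog0 false) hx (esym (add0r x)); by case: j.
have [] := hpart_eq hx (homog0 true) (esym (addr0 x)); by case: j.
Qed.

Lemma hpart_linear i : linear (hpart i).
Proof.
move=> a x y; have h := hpart_homog.
have e : a *: x + y = (a *: hpart false x + hpart false y)
                    + (a *: hpart true x + hpart true y).
  by rewrite addrACA -scalerDr -!hpart_sum.
have [] := hpart_eq _ _ e; try exact: homog_lin.
by case: i.
Qed.

HB.instance Definition _ i :=
  GRing.isLinear.Build K J J *:%R (hpart i) (hpart_linear i).

End HomogeneousComponents.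

Section Inverse.

Variables (T : choiceType) (f : T -> T) (fbij : bijective f).

Lemma bij_onto y : exists x, f x == y.
Proof. by case: fbij => g _ gK; exists (g y); rewrite gK. Qed.

Definition bij_inv (y : T) : T := xchoose (bij_onto y).

Lemma bij_invK : cancel bij_inv f.
Proof. by move=> y; apply/eqP/(xchooseP (bij_onto y)). Qed.

Lemma bijK_inv : cancel f bij_inv.
Proof. by move=> x; apply: (bij_inj fbij); rewrite bij_invK. Qed.

End Inverse.

Section Structures.

Variables (K : fieldType) (J : superspace K).

Definition even_map (f : J -> J) :=
  forall i x, x \in homog J i -> f x \in homog J i.

Definition even_mul (m : J -> J -> J) :=
  forall i j x y, x \in homog J i -> y \in homog J j ->
    m x y \in homog J (i (+) j).

(* Cyclic sum over three elements; each one carries its own parity along. *)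
Definition cycsum (F : bool -> bool -> bool -> J -> J -> J -> J)
    (i j k : bool) (x y z : J) : J :=
  F i j k x y z + F j k i y z x + F k i j z x y.

Definition bihom_ass (m : J -> J -> J) (alpha beta : J -> J) (a b c : J) : J :=
  m (m a b) (beta c) - m (alpha a) (m b c).

(* i, j, k, l are the parities of x, y, z, t. *)
Record bihom_jordan (m : {bilinear J -> J -> J})
    (alpha beta : {linear J -> J}) : Prop := BihomJordan {
  bj_mul_even : even_mul m;
  bj_alpha_even : even_map alpha;
  bj_beta_even : even_map beta;
  bj_comm : forall x, alpha (beta x) = beta (alpha x);
  bj_supercomm : forall i j x y, x \in homog J i -> y \in homog J j ->
    m (beta x) (alpha y) = (-1) ^+ (i * j) *: m (beta y) (alpha x);
  bj_jordan : forall i j k l x y z t,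
    x \in homog J i -> y \in homog J j -> z \in homog J k -> t \in homog J l ->
    cycsum (fun i j l x y t =>
        (-1) ^+ (l * (i + k)) *:
        bihom_ass m alpha beta
          (m (beta (beta x)) (alpha (beta y)))
          (alpha (alpha (beta z)))
          (alpha (alpha (alpha t))))
      i j l x y t = 0
}.

Section Star.

Variables (m : {bilinear J -> J -> J}) (alpha beta : {linear J -> J}).
Hypotheses (alpha_bij : bijective alpha) (beta_bij : bijective beta).

Let ainv : J -> J := bij_inv alpha_bij.
Let binv : J -> J := bij_inv beta_bij.

(* The formula for homogeneous arguments (see starE) extended bilinearly. *)
Definition star (x y : J) : J :=
  \sum_(i : bool) \sum_(j : bool)
    (m (hpart i x) (hpart j y)
     + (-1) ^+ (i * j) *:
       m (ainv (beta (hpart j y))) (alpha (binv (hpart i x)))).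

Lemma starE i j x y : x \in homog J i -> y \in homog J j ->
  star x y =
  m x y + (-1) ^+ (i * j) *: m (ainv (beta y)) (alpha (binv x)).
Proof.
have inv0 (f : {linear J -> J}) (fb : bijective f) : bij_inv fb 0 = 0.
  by rewrite -[X in bij_inv fb X](linear0 f) bijK_inv.
move=> hx hy; rewrite /star (bigD1 i) //= (bigD1 j) //=.
rewrite !(hpart_id _ hx) !(hpart_id _ hy) !eqxx big1 => [|b /negbTE bj].
  rewrite big1 ?addr0 // => a /negbTE ai; rewrite big1 // => b _.
  by rewrite (hpart_id _ hx) ai /binv inv0 linear0l !linear0 addr0.
by rewrite (hpart_id _ hy) bj /ainv linear0 linear0 inv0 linear0l scaler0 addr0.
Qed.

Lemma inv_linear (f : {linear J -> J}) (fb : bijective f) :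
  linear (bij_inv fb).
Proof.
by move=> a x y; apply: (bij_inj fb); rewrite linearP !bij_invK.
Qed.

Lemma star_bilinear : bilinear_for *:%R *:%R star.
Proof.
split=> u a x y; rewrite /star /= scaler_sumr -big_split /=;
  apply: eq_bigr => i _; rewrite scaler_sumr -big_split /=;
  apply: eq_bigr => j _.
- rewrite linearP linearPl [binv _]inv_linear !linearP /=.
  by rewrite scalerDr addrACA.
- rewrite !linearP [ainv _]inv_linear linearPl linearP /=.
  by rewrite scalerDr addrACA.
Qed.

HB.instance Definition _ :=
  bilinear_isBilinear.Build K J J J *:%R *:%R star star_bilinear.

End Star.

Record bihom_prejordan (m : {bilinear J -> J -> J})
    (alpha beta : {linear J -> J}) : Prop := BihomPrejordan {
  pj_mul_even : even_mul m;
  pj_alpha_even : even_map alpha;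
  pj_beta_even : even_map beta;
  pj_comm : forall x, alpha (beta x) = beta (alpha x);
  pj_alpha_bij : bijective alpha;
  pj_beta_bij : bijective beta;
  pj_alpha_mul : forall i j x y, x \in homog J i -> y \in homog J j ->
    alpha (m x y) = m (alpha x) (alpha y);
  pj_beta_mul : forall i j x y, x \in homog J i -> y \in homog J j ->
    beta (m x y) = m (beta x) (beta y);
  pj_left : forall i j k l x y z t,
    x \in homog J i -> y \in homog J j -> z \in homog J k -> t \in homog J l ->
    let st := star m pj_alpha_bij pj_beta_bij in
    let binv : J -> J := bij_inv pj_beta_bij in
    cycsum (fun i j k x y z =>
        (-1) ^+ (i * k) *:
        m (st (alpha (beta (beta x))) (alpha (alpha (beta y))))
          (m (alpha (alpha (beta z))) (alpha (alpha (alpha t)))))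
      i j k x y z
    = (-1) ^+ (i * k) *:
        m (st (st (beta (beta x)) (alpha (beta y))) (alpha (alpha (beta z))))
          (alpha (alpha (alpha (beta t))))
      + (-1) ^+ (k * (i + j)) *:
        m (alpha (alpha (beta (beta x))))
          (m (alpha (alpha (beta z)))
             (m (alpha (alpha y)) (alpha (alpha (alpha (binv t))))))
      + (-1) ^+ (i * j) *:
        m (alpha (alpha (beta (beta y))))
          (m (alpha (alpha (beta z)))
             (m (alpha (alpha x)) (alpha (alpha (alpha (binv t))))));
  pj_cyclic : forall i j k l x y z t,
    x \in homog J i -> y \in homog J j -> z \in homog J k -> t \in homog J l ->
    let st := star m pj_alpha_bij pj_beta_bij in
    cycsum (fun i j k x y z =>
        (-1) ^+ (i * k) *:
        m (alpha (alpha (beta (beta x))))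
          (m (st (alpha (beta y)) (alpha (alpha z)))
             (alpha (alpha (alpha t)))))
      i j k x y z
    = cycsum (fun i j k x y z =>
        (-1) ^+ (i * k) *:
        m (st (alpha (beta (beta x))) (alpha (alpha (beta y))))
          (m (alpha (alpha (beta z))) (alpha (alpha (alpha t)))))
      i j k x y z
}.

End Structures.

(* Main.v *)
Require Import Defs.
From HB Require Import structures.
From mathcomp Require Import all_boot all_algebra.

Set Implicit Arguments.
Unset Strict Implicit.
Unset Printing Implicit Defensive.

Import GRing.Theory.
Local Open Scope ring_scope.

(** The twist can be removed. Since [alpha] and [beta] are automorphisms of
    [circ], the product [x . y = alpha^-1 x o beta^-1 y] satisfies
    [x o y = alpha x . beta y] and [x * y = alpha x # beta y], where
    [a # b = a . b + (-1)^(|a||b|) b . a]; substituting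
    [X = alpha^3 beta^2 x], and likewise for the other variables, (P2), (P3)
    and the BiHom-Jordan identity all lose their twists. The Jordan identity
    for [#] is then expanded into words in [.] and grouped by the last letter:
    the words ending in one of the three cyclically permuted variables cancel
    by (P2), those ending in the fixed variable by (P3). *)

Lemma signr_eq (R : pzRingType) (m n : nat) :
  odd m = odd n -> (-1) ^+ m = (-1) ^+ n :> R.
Proof. by move=> e; rewrite -signr_odd e signr_odd. Qed.

(** * The untwisted Jordan identity *)

Section Untwisted.

Variables (K : fieldType) (J : superspace K) (d : {bilinear J -> J -> J}).

(** Parities are arguments, not read off the vectors, so the expansions below are formal and need no
    homogeneity. *)
Definition supersym (i j : bool) (x y : J) : J :=
  d x y + (-1) ^+ (i * j) *: d y x.

Lemma supersymC i j x y :
  supersym i j x y = (-1) ^+ (i * j) *: supersym j i y x.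
Proof.
rewrite /supersym scalerDr scalerA -exprD addrC.
by rewrite [X in X *: d x y](@signr_eq _ _ 0) ?scale1r //; case: i j => [] [].
Qed.

(** The sum common to (P2) and (P3) without twists. *)
Definition pre_assoc_sum (i j k : bool) (x y z t : J) : J :=
  cycsum (fun i j k x y z =>
    (-1) ^+ (i * k) *: d (supersym i j x y) (d z t)) i j k x y z.

Definition pre_left_id (i j k : bool) (x y z t : J) :=
  pre_assoc_sum i j k x y z t =
    (-1) ^+ (i * k) *: d (supersym (i (+) j) k (supersym i j x y) z) t
    + (-1) ^+ (k * (i + j)) *: d x (d z (d y t))
    + (-1) ^+ (i * j) *: d y (d z (d x t)).

Definition pre_cyclic_id (i j k : bool) (x y z t : J) :=
  cycsum (fun i j k x y z =>
    (-1) ^+ (i * k) *: d x (d (supersym j k y z) t)) i j k x y z =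
  pre_assoc_sum i j k x y z t.

Section JordanIdentity.

Variables (k : bool) (z : J).

Definition ass_term (i j l : bool) (x y t : J) : J :=
  (-1) ^+ (l * (i + k)) *:
    (supersym (i (+) j (+) k) l (supersym (i (+) j) k (supersym i j x y) z) t
     - supersym (i (+) j) (k (+) l) (supersym i j x y) (supersym k l z t)).

(* [ends_t], [ends_z], [ends_y], [ends_x] collect the words of [ass_term] with
   that last letter. *)
Definition ends_t (i j l : bool) x y t : J :=
  (-1) ^+ (l * (i + k)) *: d (supersym (i (+) j) k (supersym i j x y) z) t
  - (-1) ^+ (l * (i + k)) *: d (supersym i j x y) (d z t).

Definition ends_z (i j l : bool) x y t : J :=
  (-1) ^+ (l * j) *: d t (d (supersym i j x y) z)
  - (-1) ^+ (i * l) *: d (supersym i j x y) (d t z).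

Definition ends_y (i j l : bool) x y t : J :=
  (-1) ^+ (l * j + (i + j) * k) *: d t (d z (d x y))
  - (-1) ^+ (l * k + i * k + j * k + j * l) *: d (supersym k l z t) (d x y).

Definition ends_x (i j l : bool) x y t : J :=
  (-1) ^+ (l * j + (i + j) * k + i * j) *: d t (d z (d y x))
  - (-1) ^+ (l * k + i * k + j * k + j * l + i * j) *:
      d (supersym k l z t) (d y x).

(** Only right factors are expanded: a left factor does not affect the last letter, and stays whole
    as in (P2) and (P3). *)
Lemma ass_term_split i j l x y t :
  ass_term i j l x y t =
  ends_t i j l x y t + ends_z i j l x y t
  + (ends_y i j l x y t + ends_x i j l x y t).
Proof.
rewrite /ass_term /ends_t /ends_z /ends_y /ends_x.
set U := supersym i j x y; set W := supersym k l z t.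
set A := supersym (i (+) j) k U z.
have dU a : d a U = d a (d x y) + (-1) ^+ (i * j) *: d a (d y x).
  by rewrite linearD linearZ.
have dW : d U W = d U (d z t) + (-1) ^+ (k * l) *: d U (d t z).
  by rewrite linearD linearZ.
have dA : d t A = d t (d U z)
    + (-1) ^+ ((i (+) j) * k) *: d t (d z (d x y))
    + (-1) ^+ ((i (+) j) * k + i * j) *: d t (d z (d y x)).
  by rewrite linearD linearZ /= dU linearD linearZ /=
    scalerDr scalerA -exprD addrA.
rewrite {1}/supersym dA [supersym _ _ U W]/supersym dW (dU W).
rewrite !(scalerDr, scalerN, opprD, scalerA) -?exprD !addrA.
(* Pairs each positive word with the negative one having the same last letter. *)
rewrite [LHS](ACl (1*5*2*6*3*7*4*8)) /=.
by congr (_ - _ + _ - _ + _ - _ + _ - _); congr (_ *: _);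
  apply: signr_eq; case: i j k l {U W A dU dW dA} => [] [] [] [].
Qed.

Lemma ends_cancel i j l x y t : pre_left_id i j k x y z t ->
  ends_t i j l x y t + ends_y j l i y t x + ends_x l i j t x y = 0.
Proof.
(* This factor gives the leading word of (P2) the sign it has in [ends_t]. *)
move=> /(congr1 (fun v => (-1) ^+ (l * (i + k) + i * k) *: v)) /esym/eqP.
rewrite -subr_eq0 /pre_assoc_sum /cycsum => /eqP E; rewrite -[RHS]E.
(* The [ends_x] block contains [z # y], where (P2) has [y # z]. *)
rewrite /ends_t /ends_y /ends_x (supersymC k j z y) linearZl_LR.
rewrite !(scalerDr, opprD, scalerA) -!exprD !addrA.
rewrite [LHS](ACl (1*3*5*2*6*4)) /=.
by congr (_ + _ + _ - _ - _ - _); congr (_ *: _);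
  apply: signr_eq; case: i j k l {E} => [] [] [] [].
Qed.

Lemma jordan_of_prejordan i j l x y t :
  pre_left_id i j k x y z t -> pre_left_id j l k y t z x ->
  pre_left_id l i k t x z y -> pre_cyclic_id i j l x y t z ->
  cycsum ass_term i j l x y t = 0.
Proof.
move=> /(ends_cancel l) Et /(ends_cancel i) Ex /(ends_cancel j) Ey Ez.
rewrite /cycsum !ass_term_split.
(* The blocks are named by argument slot, so rotation mixes them: the four groups collect the words
   ending in [t], [x], [y] and [z]. *)
rewrite [LHS](AC (2*2*(2*2)*(2*2)) ((1*7*12)*(5*11*4)*(9*3*8)*(2*6*10))) /=.
rewrite Et Ex Ey !add0r.
move/eqP: Ez; rewrite -subr_eq0 /pre_assoc_sum /cycsum => /eqP E.
rewrite -[RHS]E /ends_z !opprD !addrA.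
by rewrite [LHS](ACl (3*5*1*2*4*6)).
Qed.

End JordanIdentity.

End Untwisted.

(** * Transfer to and from the BiHom structure *)

Section Untwist.

Variables (K : fieldType) (J : superspace K) (circ : {bilinear J -> J -> J}).
Variables (alpha beta : {linear J -> J}) (H : bihom_prejordan circ alpha beta).

Let ainv : J -> J := bij_inv (pj_alpha_bij H).
Let binv : J -> J := bij_inv (pj_beta_bij H).
Let st := star circ (pj_alpha_bij H) (pj_beta_bij H).

Definition untwist (x y : J) : J := circ (ainv x) (binv y).

Lemma untwist_bilinear : bilinear_for *:%R *:%R untwist.
Proof.
split=> u a x y; rewrite /untwist /=.
  by rewrite [ainv _]inv_linear linearPl.
by rewrite [binv _]inv_linear linearPr.
Qed.

HB.instance Definition _ :=
  bilinear_isBilinear.Build K J J J *:%R *:%R untwist untwist_bilinear.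

Notation ssym := (supersym untwist).

(** An even map commutes with the homogeneous projections; injectivity passes this to the
    inverse. *)
Lemma bij_inv_even (f : {linear J -> J}) (fb : bijective f) :
  even_map f -> even_map (bij_inv fb).
Proof.
move=> f_even i x hx; set y := bij_inv fb x.
have f_hpart : hpart i (f y) = f (hpart i y).
  rewrite {1}[y]hpart_sum linearD linearD /=.
  rewrite (hpart_id _ (f_even _ _ (hpart_homog false y))).
  rewrite (hpart_id _ (f_even _ _ (hpart_homog true y))).
  by case: i {hx}; rewrite /= ?add0r ?addr0.
suff -> : y = hpart i y by apply: hpart_homog.
by apply: (bij_inj fb); rewrite -f_hpart bij_invK (hpart_id _ hx) eqxx.
Qed.

(** Frees (P1) from its homogeneity conditions. *)
Lemma morph_of_homog (f : {linear J -> J}) :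
  (forall i j x y, x \in homog J i -> y \in homog J j ->
    f (circ x y) = circ (f x) (f y)) ->
  {morph f : x y / circ x y}.
Proof.
move=> fM x y; rewrite [x]hpart_sum [y]hpart_sum.
rewrite !(linearDl, linearD).
by rewrite !(fM _ _ _ _ (hpart_homog _ _) (hpart_homog _ _)).
Qed.

Lemma circE x y : circ x y = untwist (alpha x) (beta y).
Proof. by rewrite /untwist /ainv /binv !bijK_inv. Qed.

Lemma ainv_beta x : beta (ainv x) = ainv (beta x).
Proof.
by apply: (bij_inj (pj_alpha_bij H)); rewrite (pj_comm H) !bij_invK.
Qed.

Lemma binv_alpha x : alpha (binv x) = binv (alpha x).
Proof.
by apply: (bij_inj (pj_beta_bij H)); rewrite -(pj_comm H) !bij_invK.
Qed.

Lemma alpha_untwist x y : alpha (untwist x y) = untwist (alpha x) (alpha y).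
Proof.
rewrite /untwist (morph_of_homog (pj_alpha_mul H)).
by rewrite binv_alpha /ainv bij_invK bijK_inv.
Qed.

Lemma beta_untwist x y : beta (untwist x y) = untwist (beta x) (beta y).
Proof.
rewrite /untwist (morph_of_homog (pj_beta_mul H)).
by rewrite ainv_beta /binv bij_invK bijK_inv.
Qed.

Lemma alpha_ssym i j x y : alpha (ssym i j x y) = ssym i j (alpha x) (alpha y).
Proof. by rewrite /supersym linearD linearZ /= !alpha_untwist. Qed.

Lemma beta_ssym i j x y : beta (ssym i j x y) = ssym i j (beta x) (beta y).
Proof. by rewrite /supersym linearD linearZ /= !beta_untwist. Qed.

Lemma star_untwist i j x y : x \in homog J i -> y \in homog J j ->
  st x y = ssym i j (alpha x) (beta y).
Proof.
move=> hx hy; rewrite /st (starE _ _ _ hx hy) circE /supersym.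
(* The second summand becomes [untwist (beta y) (alpha x)] by conversion. *)
by rewrite -/ainv -/binv binv_alpha.
Qed.

Lemma star_even : even_mul st.
Proof.
move=> i j x y hx hy; rewrite /st (starE _ _ _ hx hy) addrC.
apply: homog_lin; last exact: (pj_mul_even H).
rewrite addbC; apply: (pj_mul_even H).
  by apply: bij_inv_even; [exact: (pj_alpha_even H)|exact: (pj_beta_even H)].
apply: (pj_alpha_even H); apply: bij_inv_even => //.
exact: (pj_beta_even H).
Qed.

Let a_even {i x} := @pj_alpha_even _ _ _ _ _ H i x.
Let b_even {i x} := @pj_beta_even _ _ _ _ _ H i x.
Let st_even {i j x y} := @star_even i j x y.

(* Rewriting with [beta (alpha x) = alpha (beta x)] brings every argument to
   the form [twist x]. *)
Let twist (x : J) : J := alpha (alpha (alpha (beta (beta x)))).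

Let untwistE := (alpha_ssym, beta_ssym, alpha_untwist, beta_untwist).

(** Lets (P2) and (P3), which constrain twisted arguments, reach every homogeneous element. *)
Lemma twist_onto i x : x \in homog J i ->
  exists2 y, y \in homog J i & x = twist y.
Proof.
move=> hx; exists (binv (binv (ainv (ainv (ainv x))))).
  by do 2!(apply: bij_inv_even; first exact: (pj_beta_even H));
     do 3!(apply: bij_inv_even; first exact: (pj_alpha_even H)).
by rewrite /twist /ainv /binv !bij_invK.
Qed.

(** The enclosing [circ] supplies the [alpha] still missing from [twist]. *)
Lemma star_abb_aab p q u v : u \in homog J p -> v \in homog J q ->
  st (alpha (beta (beta u))) (alpha (alpha (beta v)))
  = ssym p q (alpha (alpha (beta (beta u)))) (alpha (alpha (beta (beta v)))).
Proof.
move=> hu hv.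
rewrite (star_untwist (a_even (b_even (b_even hu)))
  (a_even (a_even (b_even hv)))).
by rewrite -!(pj_comm H).
Qed.

Lemma star_ab_aa p q u v : u \in homog J p -> v \in homog J q ->
  st (alpha (beta u)) (alpha (alpha v))
  = ssym p q (alpha (alpha (beta u))) (alpha (alpha (beta v))).
Proof.
move=> hu hv; rewrite (star_untwist (a_even (b_even hu)) (a_even (a_even hv))).
by rewrite -!(pj_comm H).
Qed.

Lemma untwist_left i j k l x y z t :
  x \in homog J i -> y \in homog J j -> z \in homog J k -> t \in homog J l ->
  pre_left_id untwist i j k x y z t.
Proof.
move=> /twist_onto[x' hx ->] /twist_onto[y' hy ->] /twist_onto[z' hz ->].
move=> /twist_onto[t' ht ->]; have := pj_left H hx hy hz ht.
rewrite /pre_left_id /pre_assoc_sum /cycsum /= -/st -/binv.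
rewrite (star_abb_aab hx hy) (star_abb_aab hy hz) (star_abb_aab hz hx).
have hxy := st_even (b_even (b_even hx)) (a_even (b_even hy)).
rewrite (star_untwist hxy (a_even (a_even (b_even hz)))).
rewrite (star_untwist (b_even (b_even hx)) (a_even (b_even hy))).
(* Nested three deep on the right, [t] receives three [beta], one of which cancels [binv]. *)
by rewrite !circE !untwistE -!(pj_comm H) /binv !bij_invK.
Qed.

Lemma untwist_cyclic i j k l x y z t :
  x \in homog J i -> y \in homog J j -> z \in homog J k -> t \in homog J l ->
  pre_cyclic_id untwist i j k x y z t.
Proof.
move=> /twist_onto[x' hx ->] /twist_onto[y' hy ->] /twist_onto[z' hz ->].
move=> /twist_onto[t' ht ->]; have := pj_cyclic H hx hy hz ht.
rewrite /pre_cyclic_id /pre_assoc_sum /cycsum /= -/st.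
rewrite (star_abb_aab hx hy) (star_abb_aab hy hz) (star_abb_aab hz hx).
rewrite (star_ab_aa hx hy) (star_ab_aa hy hz) (star_ab_aa hz hx).
by rewrite !circE !untwistE -!(pj_comm H).
Qed.

Lemma star_ass i j k l x y z t :
  x \in homog J i -> y \in homog J j -> z \in homog J k -> t \in homog J l ->
  (-1) ^+ (l * (i + k)) *:
    bihom_ass st alpha beta (st (beta (beta x)) (alpha (beta y)))
      (alpha (alpha (beta z))) (alpha (alpha (alpha t)))
  = ass_term untwist k (twist z) i j l (twist x) (twist y) (twist t).
Proof.
move=> hx hy hz ht; rewrite /bihom_ass /ass_term.
have hxy := st_even (b_even (b_even hx)) (a_even (b_even hy)).
have hz' := a_even (a_even (b_even hz)).
have ht' := a_even (a_even (a_even ht)).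
rewrite (star_untwist (st_even hxy hz') (b_even ht')).
rewrite (star_untwist (a_even hxy) (st_even hz' ht')).
rewrite (star_untwist hxy hz') (star_untwist hz' ht').
rewrite (star_untwist (b_even (b_even hx)) (a_even (b_even hy))).
by rewrite !untwistE -!(pj_comm H).
Qed.

Lemma star_supercomm i j x y : x \in homog J i -> y \in homog J j ->
  st (beta x) (alpha y) = (-1) ^+ (i * j) *: st (beta y) (alpha x).
Proof.
move=> hx hy; rewrite (star_untwist (b_even hx) (a_even hy)).
rewrite (star_untwist (b_even hy) (a_even hx)) supersymC.
by rewrite !(pj_comm H).
Qed.

Lemma twist_even i x : x \in homog J i -> twist x \in homog J i.
Proof. by move=> hx; do 3!apply: a_even; do 2!apply: b_even. Qed.

Lemma star_jordan i j k l x y z t :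
  x \in homog J i -> y \in homog J j -> z \in homog J k -> t \in homog J l ->
  cycsum (fun i j l x y t =>
    (-1) ^+ (l * (i + k)) *:
    bihom_ass st alpha beta (st (beta (beta x)) (alpha (beta y)))
      (alpha (alpha (beta z))) (alpha (alpha (alpha t)))) i j l x y t = 0.
Proof.
move=> hx hy hz ht; rewrite /cycsum.
rewrite (star_ass hx hy hz ht) (star_ass hy ht hz hx) (star_ass ht hx hz hy).
move: hx hy hz ht => /twist_even hx /twist_even hy /twist_even hz /twist_even ht.
apply: jordan_of_prejordan.
- exact: untwist_left hx hy hz ht.
- exact: untwist_left hy ht hz hx.
- exact: untwist_left ht hx hz hy.
- exact: untwist_cyclic hx hy ht hz.
Qed.

End Untwist.

Theorem theorem4p2 (K : closedFieldType) (charK : [pchar K] =i pred0)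
    (J : superspace K) (circ : {bilinear J -> J -> J})
    (alpha beta : {linear J -> J})
    (H : bihom_prejordan circ alpha beta) :
  bihom_jordan (star circ (pj_alpha_bij H) (pj_beta_bij H)) alpha beta.
Proof.
split.
- exact: star_even.
- exact: (pj_alpha_even H).
- exact: (pj_beta_even H).
- exact: (pj_comm H).
- exact: star_supercomm.
- exact: star_jordan.
Qed.
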